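(* (a) If $|\chi|=\infty$, then $\{V_{\lambda}\mid\lambda\in\widehat{G}\}$ is a representative set of isomorphism classes of simple objects in $\mathcal{W}$. (b) If $|\chi|=s<\infty$, then $\{V_{\lambda},V(\sigma,f)\mid\lambda\in\widehat{G},\ [\sigma]\in\widehat{G}/\langle\chi\rangle,\ f(y)\in\mathrm{Irr}[y]\}$ is a representative set of isomorphism classes of simple objects in $\mathcal{W}$ (one $\sigma$ being chosen in each class $[\sigma]$).
   Context: $k$ is a field, $G$ a group, $\widehat{G}$ the group of characters $G\to k^{\times}$, $\chi\in\widehat{G}$ of order $|\chi|$ (possibly $\infty$), and $a\in Z(G)$ with $\chi(a)\neq 1$. $H=kG(\chi^{-1},a,0)$ is the Hopf algebra generated as an algebra by $G$ and $x$ with relations $xg=\chi^{-1}(g)gx$ ($g\in G$), having $k$-basis $\{gx^i\mid g\in G,i\geq 0\}$, with $\Delta(x)=x\otimes a+1\otimes x$, $\varepsilon(x)=0$, $S(x)=-xa^{-1}$, and each $g\in G$ group-like. For an $H$-module $M$ and $\lambda\in\widehat{G}$, $M_{(\lambda)}=\{v\in M\mid g\cdot v=\lambda(g)v\ \forall g\in G\}$. $M$ is a weight module if $M=\bigoplus_{\lambda\in\widehat{G}}M_{(\lambda)}$; $\mathcal{W}$ is the full subcategory of left $H$-modules consisting of all weight modules. $\langle\chi\rangle$ is the subgroup of $\widehat{G}$ generated by $\chi$ and $[\sigma]$ is the class of $\sigma$ in $\widehat{G}/\langle\chi\rangle$. $V_{\lambda}$ ($\lambda\in\widehat{G}$) is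 the $1$-dimensional $H$-module with $g\cdot v=\lambda(g)v$, $x\cdot v=0$. $V(\lambda,f)$: assume $|\chi|=s<\infty$. For $\lambda\in\widehat{G}$ and a monic polynomial $f(y)=y^n-\sum_{j=0}^{n-1}\alpha_jy^j\in k[y]$ of degree $n\geq 1$, $V(\lambda,f)$ is the $H$-module with $k$-basis $m_0,\dots,m_{ns-1}$ and action $g\cdot m_i=\chi^i(g)\lambda(g)m_i$; $x\cdot m_i=m_{i+1}$ for $0\leq i\leq ns-2$; $x\cdot m_{ns-1}=\sum_{j=0}^{n-1}\alpha_jm_{js}$. $\mathrm{Irr}[y]$ is the set of monic irreducible polynomials $f(y)\in k[y]$ with $f(y)\neq y$. *)

(* Defs.v *)
From HB Require Import structures.
From mathcomp Require Import all_boot all_order all_algebra.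
From mathcomp Require Import finmap.
From mathcomp.classical Require Import boolp.
From mathcomp.multinomials Require Import monalg.

Set Implicit Arguments.
Unset Strict Implicit.
Unset Printing Implicit Defensive.

Import GRing.Theory.
Local Open Scope fset_scope.
Local Open Scope ring_scope.

(* The values are automatically nonzero (lemma char_neq0). *)
Record character (k : fieldType) (G : groupType) := Character {
  char_fun :> G -> k;
  char1 : char_fun 1%g = 1;
  charM : forall g h : G, char_fun (g * h)%g = char_fun g * char_fun h }.

HB.instance Definition _ (k : fieldType) (G : groupType) :=
  gen_eqMixin (character k G).
HB.instance Definition _ (k : fieldType) (G : groupType) :=
  gen_choiceMixin (character k G).

Section CharacterGroup.
Variables (k : fieldType) (G : groupType).
Implicit Types (chi lam mu : character k G).

Lemma char_ext lam mu : (forall g, lam g = mu g) -> lam = mu.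
Proof.
case: lam mu => [f f1 fM] [h h1 hM] /= /funext fh; subst h.
by congr Character; apply: Prop_irrelevance.
Qed.

Lemma char_neq0 lam g : lam g != 0.
Proof.
apply/eqP => lg0; have := charM lam g g^-1%g.
by rewrite mulgV char1 lg0 mul0r => /eqP; rewrite oner_eq0.
Qed.

Definition char_one : character k G :=
  @Character k G (fun=> 1) erefl (fun _ _ => esym (mulr1 1)).

Definition char_mul lam mu : character k G.
Proof.
apply: (@Character k G (fun g => lam g * mu g)).
- by rewrite !char1 mulr1.
- by move=> g h; rewrite !charM mulrACA.
Defined.

Definition char_inv lam : character k G.
Proof.
apply: (@Character k G (fun g => (lam g)^-1)).
- by rewrite char1 invr1.
- by move=> g h; rewrite charM invfM.
Defined.

Fact char_mulA : associative char_mul.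
Proof. by move=> l m n; apply: char_ext => g /=; rewrite mulrA. Qed.
Fact char_mul1 : left_id char_one char_mul.
Proof. by move=> l; apply: char_ext => g /=; rewrite mul1r. Qed.
Fact char_mulr1 : right_id char_one char_mul.
Proof. by move=> l; apply: char_ext => g /=; rewrite mulr1. Qed.
Fact char_mulV : left_inverse char_one char_inv char_mul.
Proof. by move=> l; apply: char_ext => g /=; rewrite mulVf ?char_neq0. Qed.
Fact char_mulrV : right_inverse char_one char_inv char_mul.
Proof. by move=> l; apply: char_ext => g /=; rewrite divff ?char_neq0. Qed.

HB.instance Definition _ := isGroup.Build (character k G)
  char_mulA char_mul1 char_mulr1 char_mulV char_mulrV.

Lemma char_mulE lam mu g : (lam * mu)%g g = lam g * mu g. Proof. by []. Qed.
Lemma char_oneE g : (1%g : character k G) g = 1. Proof. by []. Qed.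
Lemma char_expE lam n g : (lam ^+ n)%g g = lam g ^+ n.
Proof.
elim: n => [|n IHn]; first by rewrite expg0 expr0.
by rewrite expgS exprS char_mulE IHn.
Qed.

Definition infinite_order chi : Prop :=
  forall n : nat, (0 < n)%N -> (chi ^+ n)%g <> 1%g.

Definition has_order chi (s : nat) : Prop :=
  [/\ (0 < s)%N, (chi ^+ s)%g = 1%g &
      forall m : nat, (0 < m < s)%N -> (chi ^+ m)%g <> 1%g].

Definition in_cyclic chi mu : Prop :=
  exists n : nat, mu = (chi ^+ n)%g \/ mu = (chi ^- n)%g.

Definition same_class chi lam mu : Prop := in_cyclic chi (lam^-1 * mu)%g.

Definition is_transversal_mod chi (T : character k G -> Prop) : Prop :=
  forall lam, exists! sigma, T sigma /\ same_class chi lam sigma.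

End CharacterGroup.

Section LinearExtension.
Variables (k : fieldType) (K : choiceType) (V : lmodType k).

(* The linear map sending the basis vector << p >> to F p. *)
Definition linext (F : K -> V) (u : {malg k[K]}) : V :=
  \sum_(p <- msupp u) u@_p *: F p.

Lemma linextEw F (u : {malg k[K]}) (d : {fset K}) : msupp u `<=` d ->
  linext F u = \sum_(p <- d) u@_p *: F p.
Proof.
move=> le_ud; rewrite /linext (big_fset_incl _ le_ud) // => p _ pu.
by rewrite (mcoeff_outdom pu) scale0r.
Qed.

Fact linext_linear F : linear (linext F).
Proof.
move=> c u v; pose d := msupp (c *: u + v) `|` msupp u `|` msupp v.
have du : msupp u `<=` d by rewrite /d -fsetUA fsubsetU // fsubsetU ?fsubset_refl ?orbT.
have dv : msupp v `<=` d by rewrite fsubsetU ?fsubset_refl ?orbT.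
have duv : msupp (c *: u + v) `<=` d by rewrite /d -fsetUA fsubsetU ?fsubset_refl.
rewrite (linextEw F duv) (linextEw F du) (linextEw F dv).
rewrite scaler_sumr -big_split /=; apply: eq_bigr => p _.
by rewrite mcoeffD mcoeffZ scalerDl scalerA.
Qed.

HB.instance Definition _ F :=
  GRing.isLinear.Build k {malg k[K]} V *:%R (linext F) (linext_linear F).

Lemma linextU F p : linext F << p >> = F p.
Proof. by rewrite /linext msuppU oner_eq0 big_seq_fset1 mcoeffUU scale1r. Qed.

Lemma eq_linext F F' : F =1 F' -> linext F =1 linext F'.
Proof. by move=> eqF u; apply: eq_bigr => p _; rewrite eqF. Qed.

Lemma linext_linl (W : lmodType k) (f : {linear V -> W}) F u :
  f (linext F u) = \sum_(p <- msupp u) u@_p *: f (F p).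
Proof. by rewrite /linext linear_sum; apply: eq_bigr => p _; rewrite linearZ. Qed.

Lemma linext_addF F F' u :
  linext (fun p => F p + F' p) u = linext F u + linext F' u.
Proof.
by rewrite /linext -big_split; apply: eq_bigr => p _; rewrite scalerDr.
Qed.

Lemma linext_scaleF c F u : linext (fun p => c *: F p) u = c *: linext F u.
Proof.
by rewrite /linext scaler_sumr; apply: eq_bigr => p _; rewrite !scalerA mulrC.
Qed.

End LinearExtension.

Lemma linext_id (k : fieldType) (K : choiceType) (u : {malg k[K]}) :
  linext (fun p => << p >>) u = u.
Proof.
rewrite [RHS]monalgE; apply: eq_bigr => p _.
by apply/malgP => q; rewrite mcoeffZ !mcoeffU mulr_natr.
Qed.

(* H as an algebra: the k-vector space with basis G * nat, the pair (g, i)   *)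
(* standing for g x^i, and with (g x^i) (h x^j) = chi^-1(h)^i gh x^(i+j),    *)
(* which is what x h = chi^-1(h) h x forces. The element a of G enters only  *)
(* the comultiplication and the antipode, hence it has no bearing on the     *)
(* category of left H-modules and is not a parameter of this algebra.        *)
Definition kGx (k : fieldType) (G : groupType) (chi : character k G) : Type :=
  {malg k[(G * nat)%type]}.

Section Algebra.
Variables (k : fieldType) (G : groupType) (chi : character k G).
Local Notation H := (kGx chi).

HB.instance Definition _ := GRing.Lmodule.copy H {malg k[(G * nat)%type]}.

Definition kGx_basis (g : G) (i : nat) : H := << (g, i) >>.

Definition kGx_mul_basis (p q : G * nat) : H :=
  (chi q.1)^-1 ^+ p.2 *: kGx_basis (p.1 * q.1)%g (p.2 + q.2).

Definition kGx_mul (u v : H) : H :=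
  linext (fun p => linext (fun q => kGx_mul_basis p q) v) u.

Let lmul (p : G * nat) (v : H) : H := linext (fun q => kGx_mul_basis p q) v.

Let kGx_mulU p (v : H) : kGx_mul << p >> v = lmul p v.
Proof. by rewrite /kGx_mul linextU. Qed.

Fact kGx_mulDl : left_distributive kGx_mul +%R.
Proof. by move=> u v w; rewrite /kGx_mul linearD. Qed.

Fact kGx_mulDr : right_distributive kGx_mul +%R.
Proof.
move=> u v w; rewrite /kGx_mul -linext_addF.
by apply: eq_linext => p; rewrite linearD.
Qed.

Fact kGx_scaleAl (c : k) (u v : H) : c *: kGx_mul u v = kGx_mul (c *: u) v.
Proof. by rewrite /kGx_mul linearZ. Qed.

Fact kGx_scaleAr (c : k) (u v : H) : c *: kGx_mul u v = kGx_mul u (c *: v).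
Proof.
rewrite /kGx_mul -linext_scaleF.
by apply: eq_linext => p; rewrite linearZ.
Qed.

Let kGx_mul_sumr (u : H) (I : Type) (r : seq I) (F : I -> H) :
  kGx_mul u (\sum_(i <- r) F i) = \sum_(i <- r) kGx_mul u (F i).
Proof.
elim/big_rec2: _ => [|i x y _ IH].
  by have := kGx_scaleAr 0 u 0; rewrite !scale0r.
by rewrite kGx_mulDr IH.
Qed.

Let kGx_mul_suml (u : H) (I : Type) (r : seq I) (F : I -> H) :
  kGx_mul (\sum_(i <- r) F i) u = \sum_(i <- r) kGx_mul (F i) u.
Proof.
elim/big_rec2: _ => [|i x y _ IH].
  by have := kGx_scaleAl 0 0 u; rewrite !scale0r.
by rewrite kGx_mulDl IH.
Qed.

Let kGx_expand (u : H) : u = \sum_(p <- msupp u) u@_p *: (<< p >> : H).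
Proof. by rewrite -[LHS]linext_id. Qed.

Let kGx_mulUU p q : kGx_mul << p >> << q >> = kGx_mul_basis p q.
Proof. by rewrite kGx_mulU /lmul linextU. Qed.

Let kGx_mulUA p q r : kGx_mul << p >> (kGx_mul << q >> << r >>) =
  kGx_mul (kGx_mul << p >> << q >>) << r >>.
Proof.
rewrite !kGx_mulUU /kGx_mul_basis -kGx_scaleAr -kGx_scaleAl.
rewrite !kGx_mulUU /kGx_mul_basis /= !scalerA mulgA addnA; congr (_ *: _).
by rewrite charM invfM exprMn exprD mulrC -mulrA.
Qed.

Fact kGx_mulA : associative kGx_mul.
Proof.
move: kGx_mul kGx_mul_suml kGx_mul_sumr kGx_scaleAl kGx_scaleAr kGx_mulUA.
move=> m suml sumr scaleAl scaleAr mUA u v w.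
rewrite (kGx_expand u) !suml; apply: eq_bigr => p _.
rewrite -!scaleAl; congr (_ *: _).
rewrite (kGx_expand v) suml !sumr suml; apply: eq_bigr => q _.
rewrite -scaleAl -!scaleAr -scaleAl; congr (_ *: _).
rewrite (kGx_expand w) !sumr; apply: eq_bigr => r _.
by rewrite -!scaleAr mUA.
Qed.

Fact kGx_mul1 : left_id (kGx_basis 1%g 0) kGx_mul.
Proof.
move=> u; rewrite kGx_mulU -[RHS]linext_id; apply: eq_linext => -[g i].
by rewrite /kGx_mul_basis /= expr0 scale1r mul1g.
Qed.

Fact kGx_mulr1 : right_id (kGx_basis 1%g 0) kGx_mul.
Proof.
move=> u; rewrite -[RHS]linext_id; apply: eq_linext => -[g i].
by rewrite linextU /kGx_mul_basis /= char1 invr1 expr1n scale1r mulg1 addn0.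
Qed.

Fact kGx_one_neq0 : kGx_basis 1%g 0 != 0.
Proof.
apply/eqP => /(congr1 (mcoeff (1%g : G, 0%N))) /eqP.
by rewrite mcoeffUU mcoeff0 oner_eq0.
Qed.

HB.instance Definition _ := GRing.Zmodule_isNzRing.Build H
  kGx_mulA kGx_mul1 kGx_mulr1 kGx_mulDl kGx_mulDr kGx_one_neq0.
HB.instance Definition _ := GRing.Lmodule_isLalgebra.Build k H kGx_scaleAl.
HB.instance Definition _ := GRing.Lalgebra_isAlgebra.Build k H kGx_scaleAr.

Definition kGx_g (g : G) : H := kGx_basis g 0.
Definition kGx_x : H := kGx_basis 1%g 1.

Lemma kGx_g1 : kGx_g 1%g = 1. Proof. by []. Qed.

Lemma kGx_basisM g h i j : kGx_basis g i * kGx_basis h j =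
  (chi h)^-1 ^+ i *: kGx_basis (g * h)%g (i + j).
Proof. exact: kGx_mulUU. Qed.

Lemma kGx_gM g h : kGx_g (g * h)%g = kGx_g g * kGx_g h.
Proof. by rewrite kGx_basisM expr0 scale1r. Qed.

Lemma kGx_xg g : kGx_x * kGx_g g = (chi g)^-1 *: (kGx_g g * kGx_x).
Proof. by rewrite !kGx_basisM expr1 expr0 scale1r mul1g mulg1. Qed.

Lemma kGx_basisE g i : kGx_basis g i = kGx_g g * kGx_x ^+ i.
Proof.
elim: i => [|i IHi]; first by rewrite expr0 mulr1.
rewrite exprSr mulrA -IHi kGx_basisM char1 invr1 expr1n scale1r mulg1.
by rewrite addn1.
Qed.

Lemma kGx_expandE (u : H) :
  u = \sum_(p <- msupp u) u@_p *: (kGx_g p.1 * kGx_x ^+ p.2).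
Proof.
rewrite {1}(kGx_expand u); apply: eq_bigr => -[g i] _.
by rewrite -kGx_basisE.
Qed.

Record genmod := GenMod {
  gm_space : lmodType k;
  gm_g : G -> {linear gm_space -> gm_space};
  gm_x : {linear gm_space -> gm_space};
  gm_g1 : forall v, gm_g 1%g v = v;
  gm_gM : forall g h v, gm_g (g * h)%g v = gm_g g (gm_g h v);
  gm_xg : forall g v, gm_x (gm_g g v) = (chi g)^-1 *: gm_g g (gm_x v) }.

(* The k-vector space of N, with the left H-module structure determined by   *)
(* the given actions of the elements of G and of x (lemmas genmod_modgE,     *)
(* genmod_modxE and genmod_modcE).                                           *)
Definition genmod_mod (N : genmod) : Type := gm_space N.

Section GenModule.
Variable N : genmod.
HB.instance Definition _ := GRing.Zmodule.copy (genmod_mod N) (gm_space N).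

Let act_basis (p : G * nat) (v : gm_space N) : gm_space N :=
  gm_g N p.1 (iter p.2 (gm_x N) v).

Definition genmod_act (u : H) (v : genmod_mod N) : genmod_mod N :=
  linext (fun p => act_basis p v) u.

Let act_basisD p : {morph act_basis p : v w / v + w}.
Proof.
case: p => g i v w; rewrite /act_basis /= -linearD; congr (gm_g N g _).
by elim: i => //= i ->; rewrite linearD.
Qed.

Let act_basisZ p c v : act_basis p (c *: v) = c *: act_basis p v.
Proof.
case: p => g i; rewrite /act_basis /= -linearZ; congr (gm_g N g _).
by elim: i => //= i ->; rewrite linearZ.
Qed.

Let act_basis_sum p (I : Type) (r : seq I) (F : I -> gm_space N) :
  act_basis p (\sum_(i <- r) F i) = \sum_(i <- r) act_basis p (F i).
Proof.
elim/big_rec2: _ => [|i x y _ IH].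
  by have := act_basisZ p 0 0; rewrite !scale0r.
by rewrite act_basisD IH.
Qed.

Let iter_xg i g v : iter i (gm_x N) (gm_g N g v) =
  (chi g)^-1 ^+ i *: gm_g N g (iter i (gm_x N) v).
Proof.
elim: i => [|i IHi] /=; first by rewrite expr0 scale1r.
by rewrite IHi linearZ /= gm_xg scalerA exprSr.
Qed.

Let act_basisM p q v : act_basis p (act_basis q v) =
  (chi q.1)^-1 ^+ p.2 *: act_basis (p.1 * q.1, p.2 + q.2)%g v.
Proof.
by rewrite /act_basis /= iter_xg linearZ /= gm_gM iterD.
Qed.

Fact genmod_actA u u' v : genmod_act u (genmod_act u' v) = genmod_act (u * u') v.
Proof.
have -> : u * u' = linext (fun p => linext (fun q => kGx_mul_basis p q) u') u by [].
rewrite /genmod_act linext_linl; apply: eq_bigr => p _; congr (_ *: _).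
rewrite linext_linl {1}/linext act_basis_sum; apply: eq_bigr => q _.
rewrite act_basisZ; congr (_ *: _).
by rewrite act_basisM /kGx_mul_basis linearZ /= linextU.
Qed.

Fact genmod_act1 : left_id 1 genmod_act.
Proof. by move=> v; rewrite /genmod_act linextU /act_basis /= gm_g1. Qed.

Fact genmod_actDr : right_distributive genmod_act +%R.
Proof.
move=> u v w; rewrite /genmod_act -linext_addF.
by apply: eq_linext => p; rewrite act_basisD.
Qed.

Fact genmod_actDl v : {morph genmod_act^~ v : a b / a + b}.
Proof. by move=> a b; rewrite /genmod_act linearD. Qed.

HB.instance Definition _ := GRing.Zmodule_isLmodule.Build H (genmod_mod N)
  genmod_actA genmod_act1 genmod_actDr genmod_actDl.

Lemma genmod_modgE g (v : genmod_mod N) : kGx_g g *: v = gm_g N g v.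
Proof. by rewrite /GRing.scale /= /genmod_act linextU. Qed.

Lemma genmod_modxE (v : genmod_mod N) : kGx_x *: v = gm_x N v.
Proof.
by rewrite /GRing.scale /= /genmod_act linextU /act_basis /= gm_g1.
Qed.

Lemma genmod_modcE (c : k) (v : genmod_mod N) :
  (c%:A : H) *: v = c *: (v : gm_space N).
Proof.
rewrite {1}/GRing.scale /= /genmod_act linearZ /= linextU.
by rewrite /act_basis /= gm_g1.
Qed.

End GenModule.

Definition weight_vector (M : lmodType H) (lam : character k G) (v : M) : Prop :=
  forall g : G, kGx_g g *: v = ((lam g)%:A : H) *: v.

(* The H-submodule S of M is the internal direct sum of its weight spaces:   *)
(* each v in S is in a unique way the sum of a finitely supported family of  *)
(* weight vectors of S.                                                      *)
Definition weight_submodule (M : lmodType H) (S : {pred M}) : Prop :=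
  submod_closed S /\
  forall v : M, v \in S ->
    exists! m : {fsfun character k G -> M with 0},
      (forall lam, m lam \in S /\ weight_vector lam (m lam)) /\
      v = \sum_(lam <- finsupp m) m lam.

Definition weight_module (M : lmodType H) : Prop :=
  weight_submodule (fun _ : M => true).

(* The subobjects of M in the category of weight modules are the             *)
(* H-submodules of M that are themselves weight modules.                     *)
Definition simple_weight_module (M : lmodType H) : Prop :=
  [/\ weight_module M,
      exists v : M, v != 0 &
      forall S : {pred M}, weight_submodule S ->
        (forall v, v \in S -> v = 0) \/ (forall v, v \in S)].

Definition hmod_iso (M N : lmodType H) : Prop :=
  exists f : {linear M -> N}, bijective f.

(* The modules F i, for the indices i satisfying P, represent each           *)
(* isomorphism class of simple weight modules exactly once.                  *)
Definition represent_simples (I : Type) (P : I -> Prop) (F : I -> lmodType H) :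
    Prop :=
  [/\ forall i, P i -> simple_weight_module (F i),
      forall M : lmodType H, simple_weight_module M ->
        exists2 i, P i & hmod_iso M (F i) &
      forall i j, P i -> P j -> hmod_iso (F i) (F j) -> i = j].

Section SimpleModules.
Variable lam : character k G.

Definition V1_g (g : G) (v : k^o) : k^o := lam g *: v.
Definition V1_x (v : k^o) : k^o := 0.

Fact V1_g_linear g : linear (V1_g g).
Proof. by move=> c u v; rewrite /V1_g scalerDr !scalerA mulrC. Qed.
HB.instance Definition _ g :=
  GRing.isLinear.Build k k^o k^o *:%R (V1_g g) (V1_g_linear g).
Fact V1_x_linear : linear V1_x.
Proof. by move=> c u v; rewrite /V1_x scaler0 addr0. Qed.
HB.instance Definition _ :=
  GRing.isLinear.Build k k^o k^o *:%R V1_x V1_x_linear.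

Definition V1_genmod : genmod.
Proof.
apply: (@GenMod k^o V1_g V1_x) => /=.
- by move=> v; rewrite /V1_g char1 scale1r.
- by move=> g h v; rewrite /V1_g charM scalerA.
- by move=> g v; rewrite /V1_x /V1_g !scaler0.
Defined.

Definition V_ : lmodType H := genmod_mod V1_genmod.

Variables (s : nat) (chi_s : has_order chi s) (f : {poly k}).

Definition Vf_dim : nat := (size f).-1 * s.

(* The basis vector m_i for i < Vf_dim, and 0 for larger i. *)
Definition Vf_m (i : nat) : 'rV[k]_Vf_dim := \row_j (val j == i)%:R.

Definition Vf_g_mx (g : G) : 'M[k]_Vf_dim :=
  diag_mx (\row_i (chi ^+ i * lam)%g g).

(* Row i holds x m_i. The f`_j carry a minus sign because                   *)
(* f = y^n - \sum_(j < n) alpha_j y^j.                                       *)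
Definition Vf_x_mx : 'M[k]_Vf_dim :=
  \matrix_(i < Vf_dim)
    (if (i.+1 < Vf_dim)%N then Vf_m i.+1
     else \sum_(j < (size f).-1) - f`_j *: Vf_m (j * s)).

Fact Vf_commute g : Vf_g_mx g *m Vf_x_mx = (chi g)^-1 *: (Vf_x_mx *m Vf_g_mx g).
Proof.
have chi_gs : chi g ^+ s = 1.
  by case: chi_s => _ /(congr1 (fun l : character k G => l g)); rewrite char_expE.
apply/matrixP => i j.
rewrite [RHS]mxE mul_mx_diag mul_diag_mx !mxE !char_mulE !char_expE.
case: ltnP => [lt_i|ge_i]; rewrite ?summxE ?mxE.
  case: eqP => [->|_]; last by rewrite mul0r !mulr0.
  by rewrite !mul1r mulr1 exprS -mulrA mulKf ?char_neq0.
rewrite !mulr_suml !mulr_sumr; apply: eq_bigr => l _; rewrite !mxE.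
case: eqP => [->|_]; last by rewrite !mulr0 mul0r mulr0.
have -> : chi g ^+ (l * s) = 1 by rewrite mulnC exprM chi_gs expr1n.
have : chi g ^+ i.+1 = 1.
  have -> : i.+1 = Vf_dim by apply/eqP; rewrite eqn_leq ltn_ord.
  by rewrite /Vf_dim mulnC exprM chi_gs expr1n.
rewrite exprS => /(canRL (mulKf (char_neq0 chi g))) ->.
by rewrite !mulr1 mul1r -mulrA; congr (_ * _); apply: mulrC.
Qed.

(* V(lambda, f), on row vectors. It is only meant for f monic of positive    *)
(* degree; otherwise it is a junk value.                                     *)
Definition Vf_genmod : genmod.
Proof.
apply: (@GenMod 'rV[k]_Vf_dim (fun g => mulmxr (Vf_g_mx g)) (mulmxr Vf_x_mx)).
- move=> v /=; rewrite /Vf_g_mx -[RHS]mulmx1; congr (_ *m _).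
  apply/matrixP => i j; rewrite !mxE; case: eqP => // _.
  by rewrite char1.
- move=> g h v /=; rewrite -mulmxA; congr (_ *m _).
  rewrite /Vf_g_mx mulmx_diag; congr diag_mx; apply/rowP => i.
  by rewrite !mxE charM mulrC.
- by move=> g v /=; rewrite -mulmxA Vf_commute -scalemxAr mulmxA.
Defined.

Definition Vf : lmodType H := genmod_mod Vf_genmod.

Lemma V_gE g (v : V_) : kGx_g g *: v = ((lam g)%:A : H) *: v.
Proof. by rewrite [LHS]genmod_modgE genmod_modcE. Qed.

Lemma V_xE (v : V_) : kGx_x *: v = 0.
Proof. by rewrite [LHS]genmod_modxE. Qed.

Let mE (i : 'I_Vf_dim) : Vf_m i = delta_mx 0 i.
Proof. by apply/rowP => j; rewrite !mxE. Qed.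

Lemma Vf_gE g i : (i < Vf_dim)%N ->
  kGx_g g *: (Vf_m i : Vf) = (((chi ^+ i * lam)%g g)%:A : H) *: (Vf_m i : Vf).
Proof.
move=> lt_i; rewrite [LHS]genmod_modgE genmod_modcE /=.
rewrite -[i]/(val (Ordinal lt_i)) mE -rowE.
by apply/rowP => j; rewrite !mxE eqxx /= eq_sym mulr_natr.
Qed.

Lemma Vf_xE i : (i.+1 < Vf_dim)%N ->
  kGx_x *: (Vf_m i : Vf) = (Vf_m i.+1 : Vf).
Proof.
move=> lt_i; rewrite [LHS]genmod_modxE /=.
by rewrite -[i in LHS]/(val (Ordinal (ltnW lt_i))) mE -rowE rowK /= lt_i.
Qed.

Lemma Vf_x_lastE : (0 < Vf_dim)%N ->
  kGx_x *: (Vf_m Vf_dim.-1 : Vf) =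
  \sum_(j < (size f).-1) ((- f`_j)%:A : H) *: (Vf_m (j * s) : Vf).
Proof.
move=> d_gt0; have lt_d : (Vf_dim.-1 < Vf_dim)%N by rewrite prednK.
rewrite [LHS]genmod_modxE /=.
rewrite -[Vf_dim.-1]/(val (Ordinal lt_d)) mE -rowE rowK /= prednK // ltnn.
by apply: eq_bigr => j _; rewrite genmod_modcE.
Qed.

End SimpleModules.

End Algebra.

Definition is_Irr (k : fieldType) (f : {poly k}) : Prop :=
  [/\ f \is monic, irreducible_poly f & f != 'X].

Arguments V_ {k G} chi lam.
Arguments Vf {k G chi} lam {s} chi_s f.

(* Main.v *)
Require Import Defs.
From HB Require Import structures.
From mathcomp Require Import all_boot all_order all_algebra finmap.
From mathcomp.classical Require Import boolp.

Set Implicit Arguments.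
Unset Strict Implicit.
Unset Printing Implicit Defensive.

Import GRing.Theory.
Local Open Scope ring_scope.

(** Write H for the algebra generated by G and x, and y for x^s when chi has
    finite order s. The element x shifts weights by chi ([weight_x]), and G acts
    by scalars on weight vectors, so the submodule generated by a weight vector
    v consists of the p(x) v for p in k[X] ([xact_weight_gen]). By linear
    independence of characters, in the form of elements of k[G] that select
    one weight among finitely many ([weight_separator]), p(x) v may be cut down
    to its part of any given weight ([xact_weight_proj]). The same elements show
    that every submodule of a weight module is a weight module
    ([weight_generated_submodule]), hence a nonzero vector of a simple weight
    module generates it and Schur's lemma holds.

    A simple weight module M contains a weight vector v != 0, of weight lam. If
    some nonzero weight vector is killed by x, then M is one-dimensional
    ([simple_killed]). Otherwise x v generates M, so v = q(x) v with
    q(0) = 0 ([simple_x_back]), and both sides can be compared in weight lam.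
    If chi has infinite order, the weights of the x^i v are distinct and this
    forces v = 0 ([simple_infinite]). If chi has order s, it becomes
    v = p(y) v with p(0) = 0, so v has a minimal polynomial f with respect to y,
    which is irreducible because every q(y) v != 0 generates M again, and is not
    X because x is injective on weight vectors ([simple_minpoly]). Then
    V(lam, f) maps onto M; replacing v by some x^i v moves lam to the chosen
    representative of its class ([simple_finite]).

    All the modules of the list are treated alike: each is generated by a weight
    vector m0 such that q(x) m0 = 0 exactly when F divides q ([presented]), with
    F = X for V_lam and F = f(X^s) for V(lam, f). Maps out of such a module are
    easy to construct ([cyclic_weight_hom]), F is determined by the module up to
    a scalar ([presented_iso_eqp]), and the module is simple when F = f(X^s)
    with f irreducible and f != X: multiplying a weight vector w != 0 by a power
    of x makes it p(y) m0 with p prime to f, and a Bezout relation recovers m0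
    ([presented_simple]). *)

Lemma sum_pred1_uniq (V : nmodType) (I : eqType) (r : seq I) (i : I)
    (F : I -> V) :
  uniq r -> i \in r -> \sum_(j <- r | j == i) F j = F i.
Proof.
by move=> Ur ir; rewrite -big_filter filter_pred1_uniq // big_seq1.
Qed.

Section HModules.
Variables (k : fieldType) (G : groupType) (chi : character k G).
Local Notation H := (kGx chi).
Implicit Types (M N : lmodType H) (lam mu : character k G).
Implicit Types (p q f : {poly k}).

(** * Scalars and weight vectors *)

Lemma scalar_scalerA M (c : k) (u : H) (v : M) :
  (c *: u) *: v = (c%:A : H) *: (u *: v).
Proof. by rewrite scalerA mulr_algl. Qed.

Lemma act_scalarC M (c : k) (u : H) (v : M) :
  u *: ((c%:A : H) *: v) = (c%:A : H) *: (u *: v).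
Proof. by rewrite !scalerA mulr_algl mulr_algr. Qed.

Lemma act_scalarM M (c d : k) (v : M) :
  (c%:A : H) *: ((d%:A : H) *: v) = ((c * d)%:A : H) *: v.
Proof. by rewrite -scalar_scalerA scalerA. Qed.

Lemma act_scalar_eq0 M (c : k) (v : M) : v != 0 -> (c%:A : H) *: v = 0 -> c = 0.
Proof.
move=> v0 cv; case: (eqVneq c 0) => // c0; case/negP: v0.
have := congr1 (fun w => ((c^-1)%:A : H) *: w) cv.
by rewrite -scalar_scalerA scalerA mulVf // scale1r scale1r scaler0 => ->.
Qed.

Lemma weightA M lam c (v : M) :
  weight_vector lam v -> weight_vector lam ((c%:A : H) *: v).
Proof. by move=> wv g; rewrite act_scalarC wv act_scalarC. Qed.

Lemma weight0 M lam : weight_vector lam (0 : M).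
Proof. by move=> g; rewrite !scaler0. Qed.

Lemma weightD M lam (v w : M) :
  weight_vector lam v -> weight_vector lam w -> weight_vector lam (v + w).
Proof. by move=> wv ww g; rewrite !scalerDr wv ww. Qed.

Lemma weight_sum M lam (I : Type) (r : seq I) (P : pred I) (F : I -> M) :
  (forall i, P i -> weight_vector lam (F i)) ->
  weight_vector lam (\sum_(i <- r | P i) F i).
Proof.
by move=> wF; elim/big_ind: _ => //; [apply: weight0 | apply: weightD].
Qed.

Lemma weight_uniq M lam mu (v : M) : v != 0 ->
  weight_vector lam v -> weight_vector mu v -> lam = mu.
Proof.
move=> v0 wl wm; apply: char_ext => g; apply/eqP; rewrite -subr_eq0; apply/eqP.
by apply: (act_scalar_eq0 v0); rewrite scalerBl scalerBl -wl -wm subrr.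
Qed.

Lemma weight_hom M N (f : {linear M -> N}) lam v :
  weight_vector lam v -> weight_vector lam (f v).
Proof. by move=> wv g; rewrite -!linearZ /= wv. Qed.

Lemma weight_x M lam (v : M) :
  weight_vector lam v -> weight_vector (chi * lam)%g (kGx_x chi *: v).
Proof.
move=> wv g; rewrite char_mulE scalerA.
have -> : kGx_g chi g * kGx_x chi = chi g *: (kGx_x chi * kGx_g chi g).
  by rewrite kGx_xg scalerA divff ?char_neq0 ?scale1r.
by rewrite scalar_scalerA -scalerA wv act_scalarC act_scalarM.
Qed.

Lemma weight_xn M lam (v : M) i : weight_vector lam v ->
  weight_vector (chi ^+ i * lam)%g (kGx_x chi ^+ i *: v).
Proof.
move=> wv; elim: i => [|i IHi]; first by rewrite expg0 mul1g expr0 scale1r.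
by rewrite expgS -mulgA exprS -scalerA; apply: weight_x.
Qed.

(** The defining property is required in all modules at once, so that one
    element of H serves for every decomposition into weight vectors. *)
Definition separates (h : H) (D : seq (character k G)) mu :=
  forall M lam (v : M), weight_vector lam v ->
    (lam = mu -> h *: v = v) /\ (lam \in D -> lam != mu -> h *: v = 0).

(** Linear independence of characters: h is a product of factors
    (g - nu(g)) / (mu(g) - nu(g)), one for each nu != mu in D, with g chosen
    such that nu(g) != mu(g). *)
Lemma weight_separator D mu : exists h, separates h D mu.
Proof.
elim: D => [|nu D [h hP]].
  by exists 1 => M lam v _; split=> // _; rewrite scale1r.
have [->|ne] := eqVneq nu mu.
  exists h => M lam v wv; have [h1 h2] := hP M lam v wv.
  by split=> // /predU1P[->|/h2//]; rewrite eqxx.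
have /existsNP[g gP] : ~ forall g, nu g = mu g.
  by move/char_ext => e; rewrite e eqxx in ne.
have d0 : mu g - nu g != 0 by rewrite subr_eq0; apply/eqP => e; case: gP.
exists (h * ((mu g - nu g)^-1 *: (kGx_g chi g - (nu g)%:A))) => M lam v wv.
have [h1 h2] := hP M lam v wv.
have E : ((mu g - nu g)^-1 *: (kGx_g chi g - (nu g)%:A)) *: v =
   (((mu g - nu g)^-1 * (lam g - nu g))%:A : H) *: v.
  by rewrite scalar_scalerA scalerBl wv -!scalerBl -scalar_scalerA scalerA.
rewrite -scalerA E act_scalarC; split=> [e|].
  by rewrite h1 // e mulVf // scale1r scale1r.
case/predU1P=> [-> _|lamD lam_mu]; first by rewrite subrr mulr0 scale0r scale0r.
by rewrite h2 ?scaler0.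
Qed.

Lemma separates_sum h D mu M (I : Type) (r : seq I) (F : I -> M)
    (L : I -> character k G) :
  separates h D mu -> (forall i, weight_vector (L i) (F i)) ->
  {subset map L r <= D} ->
  h *: (\sum_(i <- r) F i) = \sum_(i <- r | L i == mu) F i.
Proof.
move=> hP wF; elim: r => [|i r IHr] sub; first by rewrite !big_nil scaler0.
rewrite !big_cons scalerDr IHr; last first.
  by move=> x xr; apply: sub; rewrite inE xr orbT.
have [h1 h2] := hP _ _ _ (wF i).
have [e|ne] := eqVneq; first by rewrite h1.
by rewrite h2 ?add0r // sub // inE eqxx.
Qed.

(** * Weight modules and their submodules *)

Definition weight_generated M := forall v : M,
  exists n (F : 'I_n -> M) (L : 'I_n -> character k G),
    (forall i, weight_vector (L i) (F i)) /\ v = \sum_i F i.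

(** The component of v in S of weight mu is h v for some h in H: this gives the
    uniqueness of the components and puts them in S. *)
Lemma weight_generated_submodule M (S : {pred M}) :
  weight_generated M -> submod_closed S -> weight_submodule S.
Proof.
move=> gen Scl; split=> // v Sv.
have [n [F [L [wF vE]]]] := gen v.
have SZ (u : H) (w : M) : w \in S -> u *: w \in S.
  by move=> Sw; rewrite -[u *: w]addr0; apply: Scl.2 => //; apply: Scl.1.
(* Components of equal weight are added up. *)
pose D := [fset L i | i in 'I_n]%fset.
pose mf lam := \sum_(i | L i == lam) F i.
have mf0 lam : lam \notin D -> mf lam = 0.
  move=> lamD; apply: big1 => i /eqP e; case/negP: lamD; rewrite -e.
  by apply/imfsetP; exists i.
pose m : {fsfun character k G -> M with 0} := [fsfun lam in D => mf lam].
have mE lam : m lam = mf lam.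
  by rewrite fsfunE; case: ifP => // /negbT /mf0.
have wm lam : weight_vector lam (m lam).
  by rewrite mE; apply: weight_sum => i /eqP <-.
have vm : v = \sum_(lam <- finsupp m) m lam.
  have -> : \sum_(lam <- finsupp m) m lam = \sum_(lam <- D) m lam.
    apply: big_fset_incl => [|lam _ /fsfun_dflt//].
    by apply: finsupp_sub.
  rewrite vE (eq_bigr _ (fun lam _ => mE lam)) /mf.
  rewrite (exchange_big_dep predT) //=; apply: eq_bigr => i _.
  rewrite (eq_bigl (eq_op^~ (L i))); last by move=> lam; rewrite eq_sym.
  by rewrite sum_pred1_uniq ?fset_uniq //; apply/imfsetP; exists i.
have component h mu (m' : {fsfun character k G -> M with 0}) D' :
    (forall lam, weight_vector lam (m' lam)) ->
    separates h D' mu -> {subset finsupp m' <= D'} ->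
    v = \sum_(lam <- finsupp m') m' lam -> h *: v = m' mu.
  move=> wm' hP sub ->; rewrite (separates_sum hP wm') ?map_id //.
  have [mu_in|mu_out] := boolP (mu \in finsupp m').
    by rewrite sum_pred1_uniq ?fset_uniq.
  rewrite fsfun_dflt // big_seq_cond big1 // => lam /andP[lam_in /eqP e].
  by rewrite -e lam_in in mu_out.
exists m; split=> [|m' [Sm' vm']].
  split=> // lam; split=> //.
  have [h hP] := weight_separator (finsupp m) lam.
  by rewrite -(component h lam m _ wm hP) //; apply: SZ.
have wm' lam : weight_vector lam (m' lam) by case: (Sm' lam).
apply/fsfunP => mu.
(* One separating element reads off the component mu of both decompositions. *)
have [h hP] := weight_separator (finsupp m ++ finsupp m') mu.
rewrite -(component h mu m _ wm hP) // => [|lam]; last by rewrite mem_cat => ->.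
by rewrite (component h mu m' _ wm' hP) // => lam; rewrite mem_cat orbC => ->.
Qed.

Lemma weight_module_generated M : weight_module M -> weight_generated M.
Proof.
move=> [_ dec] v; have [m [[wm ->] _]] := dec v isT.
exists (size (finsupp m)), (fun i => m (nth 1%g (finsupp m) i)).
exists (fun i => nth 1%g (finsupp m) i).
split=> [i|]; first by case: (wm (nth 1%g (finsupp m) i)).
by rewrite (big_nth 1%g) big_mkord.
Qed.

Lemma generated_weight_module M : weight_generated M -> weight_module M.
Proof. by move=> gen; apply: weight_generated_submodule. Qed.

Lemma weight_module_vector M : weight_module M -> (exists v : M, v != 0) ->
  exists lam (v : M), v != 0 /\ weight_vector lam v.
Proof.
move=> /weight_module_generated gen [v v0].
have [n [F [L [wF vE]]]] := gen v.
have [/existsP[i Fi0]|none] := boolP [exists i, F i != 0].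
  by exists (L i), (F i).
case/eqP: v0; rewrite vE big1 // => i _; apply/eqP.
by apply: contraNT none => Fi0; apply/existsP; exists i.
Qed.

(** * Polynomials in x acting on a module *)

Fact xact_key : unit. Proof. exact: tt. Qed.

(** The action of p(x) on v. It is locked because unification and conversion
    would otherwise unfold the product of H. *)
Definition xact M p (v : M) : M :=
  locked_with xact_key (horner_alg (kGx_x chi) p *: v).

Lemma xactE M p (v : M) : xact p v = horner_alg (kGx_x chi) p *: v.
Proof. exact: locked_withE. Qed.

Lemma xactM M p q (v : M) : xact p (xact q v) = xact (p * q) v.
Proof. by rewrite !xactE rmorphM scalerA. Qed.

Lemma xactD M p q (v : M) : xact (p + q) v = xact p v + xact q v.
Proof. by rewrite !xactE rmorphD scalerDl. Qed.

Lemma xactB M p q (v : M) : xact (p - q) v = xact p v - xact q v.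
Proof. by rewrite !xactE rmorphB scalerBl. Qed.

Lemma xact0 M (v : M) : xact 0 v = 0.
Proof. by rewrite !xactE rmorph0 scale0r. Qed.

Lemma xactr0 M p : xact p (0 : M) = 0.
Proof. by rewrite xactE scaler0. Qed.

Lemma xact1 M (v : M) : xact 1 v = v.
Proof. by rewrite !xactE rmorph1 scale1r. Qed.

Lemma xactX M (v : M) : xact 'X v = kGx_x chi *: v.
Proof. by rewrite !xactE horner_algX. Qed.

Lemma xactXn M i (v : M) : xact 'X^i v = kGx_x chi ^+ i *: v.
Proof. by rewrite !xactE rmorphXn /= horner_algX. Qed.

Lemma xactC M c (v : M) : xact c%:P v = (c%:A : H) *: v.
Proof. by rewrite !xactE horner_algC. Qed.

Lemma xactZ M c p (v : M) : xact (c *: p) v = (c%:A : H) *: xact p v.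
Proof. by rewrite -mul_polyC -xactM xactC. Qed.

Lemma xact_sum M (I : Type) (r : seq I) (F : I -> {poly k}) (v : M) :
  xact (\sum_(i <- r) F i) v = \sum_(i <- r) xact (F i) v.
Proof.
rewrite xactE linear_sum scaler_suml.
by apply: eq_bigr => i _; rewrite xactE.
Qed.

Lemma xact_hom M N (f : {linear M -> N}) p v : f (xact p v) = xact p (f v).
Proof. by rewrite !xactE linearZ. Qed.

Lemma xact_poly M n (E : nat -> k) (v : M) :
  xact (\poly_(i < n) E i) v =
  \sum_(i < n) ((E i)%:A : H) *: (kGx_x chi ^+ i *: v).
Proof.
by rewrite poly_def xact_sum; apply: eq_bigr => i _; rewrite xactZ xactXn.
Qed.

(** On a vector of weight lam, g x^i acts as a scalar multiple of x^i. The
    polynomial q depends only on u and lam, and not on the module, which is what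
    allows [cyclic_weight_hom] to compare two modules. *)
Lemma xact_weight_gen (u : H) lam :
  exists q, forall M (v : M), weight_vector lam v -> u *: v = xact q v.
Proof.
have -> := kGx_expandE u.
elim/big_ind: _ => [|u1 u2 [q1 E1] [q2 E2]|[g i] _ /=].
- by exists 0 => M v _; rewrite xact0 scale0r.
- exists (q1 + q2) => M v wv.
  by rewrite xactD scalerDl E1 // E2.
- set c := (X in X *: _); exists ((c * (chi ^+ i * lam)%g g) *: 'X^i) => M v wv.
  rewrite scalar_scalerA -scalerA (weight_xn i wv) act_scalarM.
  by rewrite xactZ xactXn.
Qed.

(** The vectors x^i v are weight vectors, and only those of weight mu can
    contribute to a sum of weight mu. *)
Lemma xact_weight_proj M lam mu q (v : M) :
  weight_vector lam v -> weight_vector mu (xact q v) ->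
  xact q v = xact (\poly_(i < size q)
                    (if (chi ^+ i * lam)%g == mu then q`_i else 0)) v.
Proof.
move=> wv wq.
pose L (i : 'I_(size q)) := (chi ^+ i * lam)%g.
have [h hP] := weight_separator (map L (index_enum 'I_(size q))) mu.
rewrite -[LHS]((hP _ _ _ wq).1 erefl) -[in LHS](coefK q) !xact_poly.
rewrite (separates_sum hP (L := L)) // => [|i]; last exact/weightA/weight_xn.
rewrite big_mkcond; apply: eq_bigr => i _; rewrite /L.
by case: ifP => // _; rewrite scale0r scale0r.
Qed.

(** * Cyclic and simple weight modules *)

Definition cyclic_vector M (v : M) := forall w : M, exists u : H, w = u *: v.

Lemma cyclic_weight_xact M lam (v : M) : weight_vector lam v ->
  cyclic_vector v -> forall w : M, exists q, w = xact q v.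
Proof.
move=> wv cv w; have [u ->] := cv w; have [q E] := xact_weight_gen u lam.
by exists q; apply: E.
Qed.

Lemma cyclic_weight_module M lam (v : M) : weight_vector lam v ->
  cyclic_vector v -> weight_module M.
Proof.
move=> wv cv; apply: generated_weight_module => w.
have [q ->] := cyclic_weight_xact wv cv w.
exists (size q).
exists (fun i : 'I_(size q) => ((q`_i)%:A : H) *: (kGx_x chi ^+ i *: v)).
exists (fun i : 'I_(size q) => chi ^+ i * lam)%g.
split=> [i|]; first exact/weightA/weight_xn.
by rewrite -[in LHS](coefK q) xact_poly.
Qed.

Lemma simple_cyclic M (v : M) :
  simple_weight_module M -> v != 0 -> cyclic_vector v.
Proof.
case=> wM _ simM v0.
pose S : {pred M} := [pred w | `[<exists u : H, w = u *: v>]].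
have Scl : submod_closed S.
  split=> [|a u w]; rewrite !inE.
    by apply/asboolP; exists 0; rewrite scale0r.
  move=> /asboolP[b ->] /asboolP[c ->]; apply/asboolP.
  by exists (a * b + c); rewrite scalerDl scalerA.
have wS := weight_generated_submodule (weight_module_generated wM) Scl.
have [S0|S1] := simM S wS; last by move=> w; have /asboolP := S1 w.
case/eqP: v0; apply: S0; rewrite inE; apply/asboolP.
by exists 1; rewrite scale1r.
Qed.

(** A nonzero weight submodule contains a nonzero weight vector, so it is enough
    to recover the generator m0 from such vectors. *)
Lemma simple_of_cyclic M lam (m0 : M) : weight_vector lam m0 -> m0 != 0 ->
  cyclic_vector m0 ->
  (forall mu (w : M), w != 0 -> weight_vector mu w ->
     exists u : H, m0 = u *: w) ->
  simple_weight_module M.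
Proof.
move=> wm m00 cm back; split.
- exact: cyclic_weight_module wm cm.
- by exists m0.
move=> S [[S0 Scl] dec].
have SZ (u : H) (w : M) : w \in S -> u *: w \in S.
  by move=> Sw; rewrite -[u *: w]addr0; apply: Scl.
have [[v Sv v0]|none] := pselect (exists2 v, v \in S & v != 0); last first.
  left=> v Sv; apply/eqP; apply: contrapT => v0; apply: none.
  by exists v => //; apply/negP.
right=> w; have [m [[wS vE] _]] := dec v Sv.
suff [mu mu0] : exists mu, m mu != 0.
  have [Smu wmu] := wS mu; have [u E] := back mu _ mu0 wmu.
  by have [u' ->] := cm w; rewrite E scalerA; apply: SZ.
apply: contrapT => none; case/eqP: v0; rewrite vE big1 // => mu _.
by apply/eqP; apply: contrapT => mu0; apply: none; exists mu; apply/negP.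
Qed.

Lemma schur M N (f : {linear M -> N}) v :
  simple_weight_module M -> simple_weight_module N -> f v != 0 -> bijective f.
Proof.
move=> sM sN fv0.
have surj w : exists u, f u = w.
  have [a ->] := simple_cyclic sN fv0 w.
  by exists (a *: v); rewrite linearZ.
have inj : injective f.
  move=> u w /eqP; rewrite -subr_eq0 -linearB /= => fuw.
  apply/eqP; rewrite -subr_eq0; apply: contraNT fv0 => uw0.
  have [a ->] := simple_cyclic sM uw0 v.
  by rewrite linearZ /= (eqP fuw) scaler0.
have [g gP] := choice surj.
by exists g => // u; apply: inj; rewrite gP.
Qed.

Lemma hmod_iso_sym M N : hmod_iso M N -> hmod_iso N M.
Proof.
case=> f [g fK gK].
pose gl := GRing.isLinear.Build H N M *:%R g (can2_linear fK gK).
pose g' : {linear N -> M} := HB.pack g gl.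
by exists g'; exists f.
Qed.

(** The map sends p(x) m0 to p(x) v. It is well defined by the hypothesis on
    annihilators, and commutes with u in H because u p(x) acts on m0 and on v as
    one and the same polynomial in x. *)
Lemma cyclic_weight_hom M N lam (m0 : M) (v : N) :
  weight_vector lam m0 -> weight_vector lam v -> cyclic_vector m0 ->
  (forall q, xact q m0 = 0 -> xact q v = 0) ->
  exists f : {linear M -> N}, f m0 = v.
Proof.
move=> wm wv cm ann.
(* P w is an arbitrary polynomial with P(w)(x) m0 = w. *)
have [P PE] := choice (cyclic_weight_xact wm cm).
pose f w := xact (P w) v.
have fE q : f (xact q m0) = xact q v.
  apply/eqP; rewrite -subr_eq0 -xactB; apply/eqP/ann.
  by rewrite xactB -PE subrr.
have fl : linear f.
  move=> a u w.
  have [q qE] := xact_weight_gen (a * horner_alg (kGx_x chi) (P u)) lam.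
  rewrite {1}(PE u) {1}(PE w) [in LHS]xactE scalerA qE // -xactD fE.
  by rewrite xactD -qE // -scalerA -xactE.
pose f' : {linear M -> N} := HB.pack f (GRing.isLinear.Build H M N *:%R f fl).
by exists f'; rewrite /= -[m0 in LHS]xact1 fE xact1.
Qed.

Lemma cyclic_weight_iso M N lam (m0 : M) (v : N) :
  weight_vector lam m0 -> weight_vector lam v -> cyclic_vector m0 ->
  (forall q, xact q m0 = 0 -> xact q v = 0) -> v != 0 ->
  simple_weight_module M -> simple_weight_module N -> hmod_iso N M.
Proof.
move=> wm wv cm ann v0 sM sN; apply: hmod_iso_sym.
have [f fm] := cyclic_weight_hom wm wv cm ann.
by exists f; apply: (schur (v := m0)); rewrite ?fm.
Qed.

(** * Modules with one generator and one relation *)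

(** M is the quotient of the module induced from the character lam of G by the
    submodule generated by F(x) m0. *)
Definition presented M lam (m0 : M) (F : {poly k}) :=
  [/\ weight_vector lam m0, cyclic_vector m0 &
      forall q, xact q m0 = 0 <-> F %| q].

(** Polynomials in x commute, so what kills the generator kills everything. *)
Lemma presented_kills M lam (m0 : M) F q : presented lam m0 F ->
  (forall w : M, xact q w = 0) <-> F %| q.
Proof.
case=> wm cm ann; split=> [/(_ m0)/ann//|/ann qm w].
have [r ->] := cyclic_weight_xact wm cm w.
by rewrite xactM mulrC -xactM qm xactr0.
Qed.

(** F generates the ideal of the polynomials p such that p(x) = 0 on M. *)
Lemma presented_iso_eqp M N lam mu (m0 : M) (n0 : N) F F' :
  presented lam m0 F -> presented mu n0 F' -> hmod_iso M N -> F %= F'.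
Proof.
move=> pM pN iMN; have [f [f' fK _]] := iMN.
have [g [g' gK _]] := hmod_iso_sym iMN.
rewrite /eqp; apply/andP; split.
  apply/(presented_kills _ pM) => w; apply: (can_inj fK).
  rewrite xact_hom linear0; exact: ((presented_kills _ pN).2 (dvdpp _)).
apply/(presented_kills _ pN) => w; apply: (can_inj gK).
rewrite xact_hom linear0; exact: ((presented_kills _ pM).2 (dvdpp _)).
Qed.

(** The module is spanned by the x^i m0, of weights chi^i lam. *)
Lemma presented_weight M lam mu (m0 w : M) F : presented lam m0 F ->
  w != 0 -> weight_vector mu w -> exists i, (chi ^+ i * lam)%g = mu.
Proof.
move=> [wm cm _] w0 ww; apply: contrapT => none; case/eqP: w0.
have [q qE] := cyclic_weight_xact wm cm w.
rewrite qE in ww *; rewrite (xact_weight_proj wm ww) xact_poly big1 // => i _.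
by case: eqP => [e|_]; [case: none; exists i | rewrite scale0r scale0r].
Qed.

Lemma dvdpX_horner0 p : ('X %| p) = (p.[0] == 0).
Proof. by rewrite -[X in X %| _]subr0 -(polyC0 k) dvdp_XsubCl. Qed.

Lemma coprimepX p : coprimep p 'X = (p.[0] != 0).
Proof. by rewrite -[X in coprimep _ X]subr0 -(polyC0 k) coprimep_XsubC. Qed.

Lemma xact_killed M (v : M) q : kGx_x chi *: v = 0 ->
  xact q v = ((q.[0])%:A : H) *: v.
Proof.
move=> xv; elim/poly_ind: q => [|q c _].
  by rewrite xact0 horner0 !scale0r.
by rewrite xactD -xactM xactX xv xactr0 add0r xactC !hornerE.
Qed.

(** * The one-dimensional modules *)

Lemma V_presented lam : presented lam ((1 : k^o) : V_ chi lam) 'X.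
Proof.
have sc c : (c%:A : H) *: ((1 : k^o) : V_ chi lam) = c.
  by rewrite [LHS]genmod_modcE; apply: mulr1.
split=> [g|w|q]; first exact: V_gE.
  by exists (w : k)%:A; rewrite sc.
by rewrite (xact_killed _ (V_xE _)) sc dvdpX_horner0; split=> /eqP.
Qed.

Lemma V_weight lam (v : V_ chi lam) : weight_vector lam v.
Proof. by move=> g; apply: V_gE. Qed.

Lemma V1_neq0 lam : ((1 : k^o) : V_ chi lam) != 0.
Proof. exact: oner_neq0. Qed.

Lemma V_simple lam : simple_weight_module (V_ chi lam).
Proof.
have [wm cm _] := V_presented lam.
apply: (simple_of_cyclic wm (V1_neq0 lam) cm) => mu w w0 _.
exists ((w : k)^-1)%:A; rewrite genmod_modcE; apply/esym.
exact: (mulVf (w0 : (w : k) != 0)).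
Qed.

Lemma V_inj lam mu : hmod_iso (V_ chi lam) (V_ chi mu) -> lam = mu.
Proof.
case=> f /bij_inj f_inj.
have f1 : f 1 != 0 by rewrite -(linear0 f) (inj_eq f_inj) V1_neq0.
by apply: (weight_uniq f1 (weight_hom f (V_weight _)) (V_weight _)).
Qed.

Lemma simple_killed M lam (v : M) : simple_weight_module M -> v != 0 ->
  weight_vector lam v -> kGx_x chi *: v = 0 -> hmod_iso M (V_ chi lam).
Proof.
move=> sM v0 wv xv; have [wm cm ann] := V_presented lam.
apply: (cyclic_weight_iso wm wv cm) => // [q /ann|]; last exact: V_simple.
rewrite dvdpX_horner0 => /eqP q0.
by rewrite xact_killed // q0 scale0r scale0r.
Qed.

(** The vector x v generates M, hence gives v back. *)
Lemma simple_x_back M (v : M) lam : simple_weight_module M ->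
  weight_vector lam v -> kGx_x chi *: v != 0 ->
  exists q, q`_0 = 0 /\ v = xact q v.
Proof.
move=> sM wv xv.
have [q E] := cyclic_weight_xact (weight_x wv) (simple_cyclic sM xv) v.
by exists (q * 'X); rewrite coefMX; split=> //; rewrite -xactM xactX.
Qed.

Lemma mulg_eq_id (g lam : character k G) : (g * lam == lam)%g = (g == 1%g).
Proof. by rewrite -{2}(mul1g lam) (inj_eq (mulIg lam)). Qed.

(** If x v != 0, then v is a combination of the x^i v with i > 0, none of which
    has the weight of v. *)
Lemma simple_infinite M : infinite_order chi -> simple_weight_module M ->
  exists lam, hmod_iso M (V_ chi lam).
Proof.
move=> inf sM; have [wM exM _] := sM.
have [lam [v [v0 wv]]] := weight_module_vector wM exM.
exists lam; apply: (simple_killed sM v0 wv); apply: contrapT => /eqP xv.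
have [q [q0 E]] := simple_x_back sM wv xv.
have := wv; rewrite {1}E => wq; case/eqP: v0.
rewrite E (xact_weight_proj wv wq) xact_poly big1 // => -[[|i] lt_i] _ /=.
  by rewrite q0 if_same scale0r scale0r.
rewrite mulg_eq_id; have /eqP/negPf -> := inf i.+1 isT.
by rewrite scale0r scale0r.
Qed.

Definition x_injective M :=
  forall mu (w : M), w != 0 -> weight_vector mu w -> kGx_x chi *: w != 0.

Lemma xn_neq0 M lam (v : M) i : x_injective M -> v != 0 ->
  weight_vector lam v -> kGx_x chi ^+ i *: v != 0.
Proof.
move=> xinj v0 wv; elim: i => [|i IHi]; first by rewrite expr0 scale1r.
by rewrite exprS -scalerA (xinj _ _ IHi (weight_xn i wv)).
Qed.

(** * Polynomials in y = x^s when chi has order s *)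

Section FiniteOrder.
Variables (s : nat) (chi_s : has_order chi s).

Let s_gt0 : (0 < s)%N. Proof. by case: chi_s. Qed.

Lemma order_dvd i : ((chi ^+ i)%g == 1%g) = (s %| i)%N.
Proof.
case: (chi_s) => _ chi1 least.
have -> : (chi ^+ i = chi ^+ (i %% s))%g.
  by rewrite {1}(divn_eq i s) expgnDr mulnC expgnA chi1 expg1n mul1g.
rewrite /dvdn; have [e|] := posnP (i %% s)%N; first by rewrite e expg0 eqxx.
move=> r0; apply/negbTE/eqP/least.
by rewrite r0 ltn_mod s_gt0.
Qed.

Lemma weight_xact_comp M lam p (v : M) :
  weight_vector lam v -> weight_vector lam (xact (p \Po 'X^s) v).
Proof.
move=> wv; rewrite comp_polyE xact_sum; apply: weight_sum => i _.
rewrite xactZ -exprM xactXn; apply: weightA.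
have := weight_xn (s * i) wv.
have /eqP -> : (chi ^+ (s * i) == 1)%g by rewrite order_dvd dvdn_mulr.
by rewrite mul1g.
Qed.

(** Since x^i v has the weight of v only when s divides i, only the monomials in
    x^s survive in q(x) v. *)
Lemma xact_same_weight M lam q (v : M) :
  weight_vector lam v -> weight_vector lam (xact q v) ->
  exists p, p`_0 = q`_0 /\ xact q v = xact (p \Po 'X^s) v.
Proof.
move=> wv wq; exists (\poly_(i < size q) q`_(i * s)); split.
  by rewrite coef_poly mul0n; case: posnP => // e; rewrite nth_default ?e.
rewrite (xact_weight_proj wv wq); set r := (X in xact X v = _).
suff -> : r = \poly_(i < size q) q`_(i * s) \Po 'X^s by [].
apply/polyP => i; rewrite {}/r.
rewrite coef_comp_poly_Xn // !coef_poly mulg_eq_id order_dvd.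
case: (boolP (s %| i)%N) => [sd|_]; last by rewrite if_same.
rewrite divnK //; case: ltnP => [lt_i|le_i].
  by rewrite (leq_ltn_trans (leq_div _ _)).
by rewrite nth_default // if_same.
Qed.

Lemma comp_Xn_horner0 p : (p \Po 'X^s).[0] = p.[0].
Proof. by rewrite horner_comp hornerXn expr0n eqn0Ngt s_gt0. Qed.

(** Otherwise f(0) = 0, so X divides the irreducible f, which is then X. *)
Lemma Irr_coprimeX f : is_Irr f -> coprimep (f \Po 'X^s) 'X.
Proof.
case=> fm [_ firr] fX; rewrite coprimepX comp_Xn_horner0.
apply: contra_neq fX => f0; have : 'X %= f.
  by apply: firr; rewrite ?size_polyX // dvdpX_horner0 f0 eqxx.
by rewrite eqp_sym eqp_monic ?monicX // => /eqP.
Qed.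

Lemma comp_Xn_inj p q : p \Po 'X^s = q \Po 'X^s -> p = q.
Proof.
move=> E; apply/polyP => i; have := congr1 (fun r : {poly k} => r`_(i * s)) E.
by rewrite !coef_comp_poly_Xn // dvdn_mull // mulnK.
Qed.

Lemma comp_Xn_monic f : f \is monic -> f \Po 'X^s \is monic.
Proof.
rewrite !monicE => /eqP fm.
by rewrite lead_coef_comp ?size_polyXn // lead_coefXn fm expr1n mulr1.
Qed.

Lemma size_Irr_comp f : is_Irr f -> (1 < size (f \Po 'X^s))%N.
Proof.
case=> _ [f1 _] _; rewrite -subn_gt0 subn1 size_comp_poly size_polyXn.
by rewrite muln_gt0 s_gt0 andbT -subn1 subn_gt0.
Qed.

Lemma presented_neq0 M lam (m0 : M) f : is_Irr f ->
  presented lam m0 (f \Po 'X^s) -> m0 != 0.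
Proof.
move=> fI [_ _ ann]; apply/eqP => e.
have /ann : xact 1 m0 = 0 by rewrite e xactr0.
by rewrite dvdp1 eqn_leq leqNgt size_Irr_comp.
Qed.

(** A nonzero weight vector w = q(x) m0 has weight chi^i lam for some i, so that
    x^e w has weight lam for a suitable e and is p(y) m0. As f(X^s) is prime to
    X and does not divide q, it does not divide X^e q either; hence f does not
    divide p, and a f + b p = 1 gives m0 = b(y) x^e w. *)
Lemma presented_simple M lam (m0 : M) f : is_Irr f ->
  presented lam m0 (f \Po 'X^s) -> simple_weight_module M.
Proof.
move=> fI pM; have [wm cm ann] := pM; have [fm firr fX] := fI.
have m00 := presented_neq0 fI pM.
apply: (simple_of_cyclic wm m00 cm) => mu w w0 ww.
have [i iE] := presented_weight pM w0 ww.
have [q qE] := cyclic_weight_xact wm cm w.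
(* chi^e is the inverse of chi^i, since e + i = s i. *)
pose e := (s.-1 * i)%N.
have wxe : weight_vector lam (xact ('X^e * q) m0).
  rewrite -xactM xactXn -qE -[lam]mul1g.
  have -> : 1%g = (chi ^+ e * chi ^+ i)%g.
    apply/esym/eqP; rewrite -expgnDr order_dvd /e -[in X in (_ + X)%N](mul1n i).
    by rewrite -mulnDl addn1 prednK // dvdn_mulr.
  by rewrite -mulgA iE; apply: weight_xn.
have [p [_ pE]] := xact_same_weight wm wxe.
have fp : coprimep f p.
  rewrite (irreducible_poly_coprime p firr).
  apply/negP => fp; case/eqP: w0.
  have Fp : f \Po 'X^s %| p \Po 'X^s by exact: dvdp_comp_poly.
  have : f \Po 'X^s %| 'X^e * q by apply/ann; rewrite pE; apply/ann.
  rewrite Gauss_dvdpr; first by move/ann; rewrite -qE.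
  by apply: coprimep_expr; apply: Irr_coprimeX.
have [[a b] /= ab] := Bezout_eq1_coprimepP _ _ fp.
have fm0 : xact (f \Po 'X^s) m0 = 0 by apply/ann.
exists (horner_alg (kGx_x chi) ((b \Po 'X^s) * 'X^e)).
rewrite -xactE qE xactM -mulrA -[RHS]xactM pE [RHS]xactM -comp_polyM.
have -> : b * p = 1 - a * f by rewrite -ab addrC addKr.
by rewrite comp_polyB comp_polyM comp_polyC xactB xact1 -xactM fm0 xactr0 subr0.
Qed.

(** The minimal polynomial f of v with respect to y exists because v = p0(y) v
    for some p0 with p0(0) = 0, so that 1 - p0 is a nonzero annihilator. If
    f = d q1, then either q1(y) v = 0 and q1 has the degree of f, or q1(y) v
    generates M, whence v = p(y) q1(y) v and d(y) v = p(y) f(y) v = 0, so that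
    d has the degree of f. *)
Lemma simple_minpoly M lam (v : M) : simple_weight_module M ->
  x_injective M -> v != 0 -> weight_vector lam v ->
  exists2 f, is_Irr f & xact (f \Po 'X^s) v = 0.
Proof.
move=> sM xinj v0 wv.
pose A p := xact (p \Po 'X^s) v = 0.
have [q [q0 E]] := simple_x_back sM wv (xinj _ _ v0 wv).
have := wv; rewrite {1}E => /(xact_same_weight wv)[p0 [p00 p0E]].
pose P n := `[< exists p, [/\ p != 0, A p & size p = n] >].
have exP : exists n, P n.
  exists (size (1 - p0)); apply/asboolP; exists (1 - p0).
  apply: And3 erefl.
    apply/eqP => /(congr1 (fun r : {poly k} => r`_0)).
    by rewrite coefB coef1 p00 q0 coef0 subr0 => /eqP; rewrite oner_eq0.
  by rewrite /A comp_polyB comp_polyC xactB xact1 -p0E -E subrr.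
have [n /asboolP[f1 [f10 Af1 <-]] least] := ex_minnP exP.
pose f := (lead_coef f1)^-1 *: f1.
have lc0 : lead_coef f1 != 0 by rewrite lead_coef_eq0.
have sf : size f = size f1 by apply: size_scale; rewrite invr_eq0.
have Af : A f by rewrite /A comp_polyZ xactZ Af1 scaler0.
have f0 : f != 0 by rewrite -size_poly_eq0 sf size_poly_eq0.
have fm : f \is monic by rewrite monicE lead_coefZ mulVf.
have {}least p : p != 0 -> A p -> (size f <= size p)%N.
  move=> pn0 Ap; rewrite sf; apply: least; apply/asboolP.
  by exists p; exact: And3 pn0 Ap erefl.
clearbody f; move=> {f1 f10 Af1 lc0 sf exP P}.
exists f; last exact: Af.
split; [exact: fm| |]; last first.
  apply/eqP => fX; move: Af; rewrite /A fX comp_polyX xactXn; apply/eqP.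
  exact: xn_neq0 xinj v0 wv.
split=> [|q1 q1n q1f].
  rewrite ltnNge; apply/negP => /size1_polyC fC.
  move: Af f0; rewrite /A fC comp_polyC xactC => /(act_scalar_eq0 v0) ->.
  by rewrite polyC0 eqxx.
have fE := divpK q1f; set d := f %/ q1 in fE.
have q10 : q1 != 0 by apply: contraNneq f0 => e; rewrite -fE e mulr0.
have d0 : d != 0 by apply: contraNneq f0 => e; rewrite -fE e mul0r.
have [Aq|nAq] := pselect (A q1).
  by rewrite -(dvdp_size_eqp q1f) eqn_leq (dvdp_leq f0 q1f) (least _ q10 Aq).
have w0 : xact (q1 \Po 'X^s) v != 0 by apply/eqP.
have ww := weight_xact_comp q1 wv.
have [r rE] := cyclic_weight_xact ww (simple_cyclic sM w0) v.
have := wv; rewrite {1}rE => /(xact_same_weight ww)[p [_ pE]].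
have Ad : A d.
  rewrite /A rE pE !xactM [_ * (p \Po _)]mulrC -mulrA -xactM -comp_polyM fE.
  by rewrite Af xactr0.
have := least _ d0 Ad; rewrite -{1}fE (size_mul d0 q10).
rewrite -subn1 leq_subLR addnC leq_add2r => le_q1.
by case/negP: q1n; rewrite eqn_leq le_q1 size_poly_gt0.
Qed.

(** * The modules V(lam, f) *)

Section Vf.
Variables (lam : character k G) (f : {poly k}).
Hypothesis fI : is_Irr f.
Local Notation d := (Vf_dim s f).
Local Notation V := (Vf lam chi_s f).
Local Notation m i := (Vf_m s f i : V).

Let n_gt0 : (0 < (size f).-1)%N.
Proof. by case: fI => _ [f1 _] _; rewrite -subn1 subn_gt0. Qed.

Let d_gt0 : (0 < d)%N. Proof. by rewrite muln_gt0 n_gt0. Qed.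

Lemma Vf_xn i : (i < d)%N -> kGx_x chi ^+ i *: m 0 = m i.
Proof.
elim: i => [|i IHi] lt_i; first by rewrite expr0 scale1r.
by rewrite exprS -scalerA IHi ?(ltnW lt_i) // Vf_xE.
Qed.

Lemma Vf_rVpoly (v : 'rV[k]_d) : xact (rVpoly v) (m 0) = (v : V).
Proof.
rewrite xact_poly [RHS]row_sum_delta; apply: eq_bigr => i _.
rewrite Vf_xn // genmod_modcE.
case: insubP => [j _ ji|]; last by rewrite ltn_ord.
rewrite (val_inj ji); apply/rowP => l.
by rewrite !mxE.
Qed.

(** The value of x on the last basis vector is chosen to make f(y) m_0 = 0. *)
Lemma Vf_relation : xact (f \Po 'X^s) (m 0) = 0.
Proof.
have [fm _ _] := fI.
have sfE : size f = (size f).-1.+1.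
  by rewrite prednK // size_poly_gt0 monic_neq0.
rewrite comp_polyE xact_sum sfE big_ord_recr /=.
have -> : f`_(size f).-1 = 1 by apply/eqP; rewrite -[_ == _]/(f \is monic).
rewrite scale1r -exprM xactXn mulnC -/d -(prednK d_gt0) exprS -scalerA.
rewrite Vf_xn ?prednK // Vf_x_lastE // -big_split big1 //= => j _.
rewrite xactZ -exprM xactXn mulnC Vf_xn; last by rewrite ltn_pmul2r.
by rewrite -scalerDl -scalerDl subrr scale0r scale0r.
Qed.

(** A polynomial r of degree less than d, the degree of f(X^s), takes m_0 to the
    row vector of its coefficients, so a remainder modulo f(X^s) kills m_0 only
    if it is 0. *)
Lemma Vf_presented : presented lam (m 0) (f \Po 'X^s).
Proof.
have [fm _ _] := fI.
split=> [g|w|q].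
- by rewrite (Vf_gE lam chi_s g d_gt0) expg0 mul1g.
- exists (horner_alg (kGx_x chi) (rVpoly (w : 'rV[k]_d))).
  by rewrite -xactE Vf_rVpoly.
have Fn0 : f \Po 'X^s != 0 by rewrite monic_neq0 // comp_Xn_monic.
rewrite {1}(divp_eq q (f \Po 'X^s)) xactD -xactM Vf_relation.
rewrite xactr0 add0r; set r := q %% _.
have sr : (size r <= d)%N.
  have : (size r < size (f \Po 'X^s))%N by rewrite ltn_modp.
  rewrite -[size (_ \Po _)]prednK ?size_poly_gt0 //.
  by rewrite size_comp_poly size_polyXn.
rewrite -(poly_rV_K sr) Vf_rVpoly; split.
  by move=> /(congr1 rVpoly); rewrite (poly_rV_K sr) linear0 => /eqP.
by move=> /eqP r0; rewrite /r in sr *; rewrite r0 linear0.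
Qed.

Lemma Vf_simple : simple_weight_module V.
Proof. exact: presented_simple fI Vf_presented. Qed.

End Vf.

(** * The classification when chi has finite order *)

Lemma same_classE lam sigma : same_class chi lam sigma ->
  exists i, sigma = (chi ^+ i * lam)%g.
Proof.
have [_ chi1 _] := chi_s.
case=> n cl; suff [i iE] : exists i, (lam^-1 * sigma)%g = (chi ^+ i)%g.
  exists i; rewrite -iE; apply: char_ext => g.
  by rewrite !char_mulE mulrAC mulVf ?char_neq0 ?mul1r.
case: cl => ->; first by exists n.
(* chi^(-n) = chi^((s - 1) n) because chi^s = 1. *)
exists (s.-1 * n)%N; apply: (mulIg (chi ^+ n)%g).
rewrite mulVg -expgnDr -mulSnr prednK // expgnA chi1.
by rewrite expg1n.
Qed.

Lemma same_class_expM lam i : same_class chi lam (chi ^+ i * lam)%g.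
Proof.
exists i; left; apply: char_ext => g.
by rewrite !char_mulE mulrCA mulVf ?char_neq0 ?mulr1.
Qed.

(** If x is injective on weight vectors, x^i v is nonzero of weight chi^i lam
    for every i, and some chi^i lam is in T. *)
Lemma simple_finite M (T : character k G -> Prop) :
  is_transversal_mod chi T -> simple_weight_module M ->
  (exists lam, hmod_iso M (V_ chi lam)) \/
  (exists sigma f, [/\ T sigma, is_Irr f & hmod_iso M (Vf sigma chi_s f)]).
Proof.
move=> trT sM; have [wM exM _] := sM.
have [[mu [w [w0 ww xw]]]|none] := pselect (exists mu (w : M),
    [/\ w != 0, weight_vector mu w & kGx_x chi *: w = 0]).
  by left; exists mu; apply: (simple_killed sM w0 ww xw).
right; have xinj : x_injective M.
  by move=> mu w w0 ww; apply/eqP => xw; apply: none; exists mu, w.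
have [lam [v [v0 wv]]] := weight_module_vector wM exM.
have [sigma [[Tsigma /same_classE[i iE]] _]] := trT lam.
have xi0 := xn_neq0 i xinj v0 wv.
have wxi := weight_xn i wv; rewrite -iE in wxi.
have [f fI fv] := simple_minpoly sM xinj xi0 wxi.
exists sigma, f; split=> //.
have [wm cm ann] := Vf_presented sigma fI.
apply: (cyclic_weight_iso wm wxi cm _ xi0 (Vf_simple sigma fI) sM) => q /ann qf.
by rewrite -(divpK qf) -xactM fv xactr0.
Qed.

(** The relations X and f(X^s) are coprime, hence not associate. *)
Lemma V_not_Vf lam sigma f : is_Irr f ->
  ~ hmod_iso (V_ chi lam) (Vf sigma chi_s f).
Proof.
move=> fI iso.
have := presented_iso_eqp (V_presented lam) (Vf_presented sigma fI) iso.
move=> /(eqp_coprimepr (f \Po 'X^s)); rewrite (Irr_coprimeX fI) coprimepp.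
by rewrite eqn_leq leqNgt size_Irr_comp.
Qed.

(** The relation f(X^s) determines f. The image of m_0 has weight sigma in
    V(tau, g), whose weights all lie in the class of tau. *)
Lemma Vf_inj (T : character k G -> Prop) sigma tau f g :
  is_transversal_mod chi T -> T sigma -> T tau -> is_Irr f -> is_Irr g ->
  hmod_iso (Vf sigma chi_s f) (Vf tau chi_s g) -> (sigma, f) = (tau, g).
Proof.
move=> trT Ts Tt fI gI iso.
have [fm _ _] := fI; have [gm _ _] := gI.
have pf := Vf_presented sigma fI; have pg := Vf_presented tau gI.
congr pair; last first.
  apply: comp_Xn_inj; apply/eqP.
  by rewrite -eqp_monic ?comp_Xn_monic ?(presented_iso_eqp pf pg).
have [h /bij_inj h_inj] := iso; have [wm cm _] := pf.
have h0 : h (Vf_m s f 0) != 0.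
  rewrite -(linear0 h) (inj_eq h_inj).
  exact: presented_neq0 fI pf.
have [i iE] := presented_weight pg h0 (weight_hom h wm).
have [rho [_ uniq_rho]] := trT tau.
have Es : rho = sigma.
  by apply: uniq_rho; split; rewrite // -iE; apply: same_class_expM.
have Et : rho = tau.
  apply: uniq_rho; split; rewrite // -[X in same_class _ _ X]mul1g.
  exact: (same_class_expM tau 0).
by rewrite -Es -Et.
Qed.

End FiniteOrder.
End HModules.

Theorem corollary3p11 (k : fieldType) (G : groupType) (chi : character k G)
    (a : G) (a_central : forall g : G, commute a g) (chi_a : chi a != 1) :
  (infinite_order chi ->
     represent_simples (fun _ : character k G => True)
                       (fun lam => V_ chi lam)) /\
  (forall (s : nat) (chi_s : has_order chi s) (T : character k G -> Prop),
     is_transversal_mod chi T ->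
     represent_simples
       (fun i : character k G + character k G * {poly k} =>
          match i with
          | inl lam => True
          | inr (sigma, f) => T sigma /\ is_Irr f
          end)
       (fun i =>
          match i with
          | inl lam => V_ chi lam
          | inr (sigma, f) => Vf sigma chi_s f
          end)).
Proof.
split=> [inf|s chi_s T trT]; split.
- by move=> lam _; apply: V_simple.
- by move=> M /(simple_infinite inf)[lam iso]; exists lam.
- by move=> lam mu _ _; apply: V_inj.
- by case=> [lam _|[sigma f] [_ fI]]; [apply: V_simple | apply: Vf_simple].
- move=> M /(simple_finite chi_s trT)[[lam iso]|[sigma [f [Ts fI iso]]]].
    by exists (inl lam).
  by exists (inr (sigma, f)).
- case=> [lam|[sigma f]] [mu|[tau g]].
  + by move=> _ _ /V_inj ->.
  + by move=> _ [_ gI] /(V_not_Vf gI).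
  + by move=> [_ fI] _ /hmod_iso_sym/(V_not_Vf fI).
  + by move=> [Ts fI] [Tt gI] /(Vf_inj trT Ts Tt fI gI) ->.
Qed.
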